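(* Let $A$ be a commutative ring with unit, let $M$ be a free $A$-module of finite rank $r$, let $f\in \mathrm{End}_A(M)$, and let $D_i\in\mathrm{End}_A(\bigwedge M)$ ($i\ge 0$) and $e_1,\dots,e_r\in A$ be the endomorphisms and scalars attached to $f$ as described in the context. Then: (1) For $1\leq k<r$, the endomorphism $$D_k-e_1D_{k-1}+\cdots+(-1)^ke_k\mathbf 1$$ of $\bigwedge M$ vanishes on $\bigwedge^{>(r-k)}M$. (2) For $i\geq r$, the endomorphism $$D_i-e_1D_{i-1}+\cdots+(-1)^re_rD_{i-r}$$ vanishes on the whole of $\bigwedge M$.
   Context: $\bigwedge M=\bigoplus_{j=0}^r\bigwedge^jM$ is the exterior algebra over $A$, with $\bigwedge^0M=A$, and $\bigwedge^{>i}M=\bigoplus_{j=i+1}^r\bigwedge^jM$. $\mathbf 1$ denotes the identity endomorphism, and $f^0=\mathbf 1$. For a formal power series $P(t)=\sum_{i\ge0}p_it^i$ with $p_i\in\mathrm{End}_A(M)$, the $A$-linear map $\bigwedge P(t):\bigwedge M\to(\bigwedge M)[[t]]$ is defined to be the identity on $\bigwedge^0M=A$, and, for $j\geq 1$, to send $m_1\wedge\cdots\wedge m_j\mapsto P(t)m_1\wedge\cdots\wedge P(t)m_j$ ($m_1,\dots,m_j\in M$). The endomorphisms $D_i$ are the coefficients of $D(t)=\sum_{i\ge0}D_it^i=\bigwedge\left(\sum_{i\ge0}f^it^i\right)$; in particular $D_0=\mathbf 1$ and $D_i|_M=f^i$. The scalars $e_1,\dots,e_r\in A$ are defined by $\det(\mathbf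 1-ft)=1-e_1t+e_2t^2-\cdots+(-1)^re_rt^r$; equivalently, the characteristic polynomial of $f$ is $\det(t\mathbf 1-f)=t^r-e_1t^{r-1}+\cdots+(-1)^re_r$.
   Formalization: In (2) with i = r, vanishing is proved only on ⋀^{>0}M, not on ⋀^0 M = A, where the operator is multiplication by (-1)^r e_r and the printed claim fails (e.g. A = Z, r = 1, f = 1); for i > r it is proved on all of ⋀M. A is taken to be nonzero. *)

(* Defs.v *)
From HB Require Import structures.
From mathcomp Require Import all_boot all_order all_algebra.

Set Implicit Arguments.
Unset Strict Implicit.
Unset Printing Implicit Defensive.

Import GRing.Theory.
Local Open Scope ring_scope.

(* Over a nonzero commutative ring A, a free module of finite rank r is a     *)
(* vectType M over A with dim M = r (isomorphic to 'rV[A]_r).                 *)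

(* The exterior algebra is not in the library, so it is specified by its      *)
(* universal property: (E, iota) is universal among the A-algebras equipped   *)
(* with a linear map from M whose values have square zero.                    *)
Definition is_exterior_algebra (A : comNzRingType) (M : lmodType A)
    (E : algType A) (iota : {linear M -> E}) : Prop :=
  (forall m, iota m * iota m = 0) /\
  (forall (B : algType A) (phi : {linear M -> B}),
     (forall m, phi m * phi m = 0) ->
     exists psi : {lrmorphism E -> B},
       (forall m, psi (iota m) = phi m) /\
       (forall psi' : {lrmorphism E -> B},
          (forall m, psi' (iota m) = phi m) -> psi' =1 psi)).

Section ExteriorPowers.
Variables (A : comNzRingType) (M : vectType A) (E : algType A).
Variable iota : {linear M -> E}.

(* m_1 /\ ... /\ m_j; the empty product, for j = 0, is 1. *)
Definition wedge j (m : 'I_j -> M) : E := \prod_(l < j) iota (m l).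

(* The submodule /\^j M, for j = 0 the copy A%:A of A. *)
Definition in_ext_power j (x : E) : Prop :=
  exists n (c : 'I_n -> A) (m : 'I_n -> 'I_j -> M),
    x = \sum_(s < n) c s *: wedge (m s).

(* The submodule /\^{>i} M, the sum of the /\^j M for i < j <= r. *)
Definition in_ext_gt i (x : E) : Prop :=
  exists y : nat -> E,
    (forall j, in_ext_power j (y j)) /\ x = \sum_(i.+1 <= j < (dim M).+1) y j.

End ExteriorPowers.

(* A formal power series over E is its sequence of coefficients. *)
Definition ps_one (E : pzRingType) : nat -> E := fun i => (i == 0%N)%:R.

Definition ps_mul (E : pzRingType) (P Q : nat -> E) : nat -> E :=
  fun i => \sum_(k < i.+1) P k * Q (i - k)%N.

(* [D] is the sequence of coefficients of /\P(t): the linear maps D i are     *)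
(* determined on the products of elements of M, which span E.                 *)
Definition is_wedge_series (A : comNzRingType) (M : vectType A)
    (E : algType A) (iota : {linear M -> E})
    (P : nat -> 'End(M)) (D : nat -> {linear E -> E}) : Prop :=
  (forall (a : A) i, D i a%:A = if i == 0%N then a%:A else 0) /\
  (forall j (m : 'I_j -> M) i, (0 < j)%N ->
     D i (wedge iota m) =
     (\big[@ps_mul E/@ps_one E]_(l < j) (fun k => iota (P k (m l)))) i).

Definition lfun_pow (A : comNzRingType) (M : vectType A) (f : 'End(M))
    (i : nat) : 'End(M) :=
  iter i (comp_lfun f) \1%VF.

(* The matrix of f in the coordinates of M (acting on row vectors). *)
Definition lfun_mx (A : comNzRingType) (M : vectType A) (f : 'End(M)) :
    'M[A]_(dim M) :=
  VectorInternalTheory.f2mx f.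

(* det(1 - f t), as a polynomial in t. *)
Definition det_one_sub (A : comNzRingType) (M : vectType A) (f : 'End(M)) :
    {poly A} :=
  \det (1%:M - 'X *: map_mx polyC (lfun_mx f)).

(* e_k, from det(1 - f t) = \sum_k (-1)^k e_k t^k; thus e_0 = 1. *)
Definition esc (A : comNzRingType) (M : vectType A) (f : 'End(M)) (k : nat) :
    A :=
  (-1) ^+ k * (det_one_sub f)`_k.

(* The value at x of D_i - e_1 D_{i-1} + ... + (-1)^k e_k D_{i-k}, k <= i.    *)
Definition ch_op (A : comNzRingType) (M : vectType A) (f : 'End(M))
    (E : algType A) (D : nat -> {linear E -> E}) (k i : nat) (x : E) : E :=
  \sum_(l < k.+1) (-1) ^+ l *: (esc f l *: D (i - l)%N x).

(* On /\^0 M = A the operator with k = i is multiplication by (-1)^i e_i.     *)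
(* So D_r - e_1 D_{r-1} + ... + (-1)^r e_r D_0 vanishes on /\^{>0} M, but not *)
(* on /\^0 M unless e_r = 0.                                                  *)
Lemma ch_op_degree0 (A : comNzRingType) (M : vectType A) (f : 'End(M))
    (E : algType A) (iota : {linear M -> E}) (D : nat -> {linear E -> E}) :
  is_wedge_series iota (lfun_pow f) D ->
  forall i (a : A), ch_op f D i i a%:A = ((-1) ^+ i * esc f i * a)%:A.
Proof.
move=> [D0 _] i a; rewrite /ch_op big_ord_recr /= subnn D0 eqxx !scalerA.
rewrite big1 ?add0r ?mulrA // => l _.
by rewrite D0 subn_eq0 leqNgt ltn_ord /= !scaler0.
Qed.

(* Main.v *)
Require Import Defs.
From HB Require Import structures.
From mathcomp Require Import boolp all_boot all_order all_algebra all_fingroup.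
Set Implicit Arguments.
Unset Strict Implicit.
Unset Printing Implicit Defensive.
Import GRing.Theory.
Local Open Scope ring_scope.

(** Write E for the exterior algebra, F for the matrix of f and
    X = 1 - t F, so that det X = sum_k (-1)^k e_k t^k. The endomorphism
    D_i - e_1 D_(i-1) + ... + (-1)^i e_i is the coefficient of t^i in
    det X * D(t). Everything follows from one fact: on the j-th exterior power
    the series det X * D(t) is a polynomial of degree at most r - j
    ([ch_op_wedge]).

    Let V be the j x r matrix whose l-th row holds the coordinates of
    (1 - t f)^-1 m_l. Expanding D(t)(m_1 /\ ... /\ m_j) in the basis gives a
    sum over all maps phi : {1..j} -> {1..r} of (prod_l V_(l, phi l)) times a
    product of basis vectors, which alternates in phi. Grouping the maps phi
    that differ by a permutation of {1..j} turns the coefficients into the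
    j x j minors of V ([sum_alternating_eq0]), so it is enough to bound the
    degree of det X times such a minor. This is Jacobi's complementary minor
    argument ([trunc_deg_le_minor]): complete V to a square matrix by r - j
    unit rows, so that its determinant is the given minor up to sign, and
    multiply by X on the right. The first j rows become V X, which is
    constant in t, and the others become rows of X, which have degree 1 in t;
    hence the determinant of the product has degree at most r - j.

    Power series over A are handled through polynomials that represent them
    modulo t^(N+1); [trunc_deg_le N d] is the resulting notion of degree.

    For i > r the statement concerns every element of E, so it also needs that
    products of elements of M span E. Their span is a subalgebra through which
    the universal property factors the identity of E ([exterior_spanned]). *)

(** * Sums against an alternating function *)

Section AlternatingSum.
Variables (A : comNzRingType) (N : lmodType A) (I J : finType).
Implicit Types (phi : {ffun I -> J}) (s : {perm I}).

Definition ffperm phi s : {ffun I -> J} := [ffun x => phi (s x)].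

Lemma ffperm_trans phi0 phi : injective phi0 -> injective phi ->
  [set phi0 x | x in I] = [set phi x | x in I] -> exists s, phi = ffperm phi0 s.
Proof.
move=> inj0 inj1 eq_im.
have pre x : phi x \in codom phi0.
  have : phi x \in [set phi0 y | y in I] by rewrite eq_im imset_f.
  by case/imsetP => y _ ->; apply: codom_f.
have inj_s : injective (fun x => iinv (pre x)).
  by move=> x y eq_xy; apply: inj1; rewrite -(f_iinv (pre x)) eq_xy f_iinv.
by exists (perm inj_s); apply/ffunP => x; rewrite ffunE permE f_iinv.
Qed.

(** The injective maps with a given image form a single free orbit of the
    permutations of I, on which g is constant up to the sign; so only the
    signed sums of a over the orbits matter. *)
Lemma sum_alternating_eq0 (a : {ffun I -> J} -> A) (g : {ffun I -> J} -> N) :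
  (forall phi, ~~ injectiveb phi -> g phi = 0) ->
  (forall phi s, g (ffperm phi s) = (-1) ^+ s *: g phi) ->
  (forall phi, injective phi ->
     \sum_s (-1) ^+ odd_perm s * a (ffperm phi s) = 0) ->
  \sum_phi a phi *: g phi = 0.
Proof.
move=> g0 gs as0.
rewrite (bigID (fun phi => injectiveb phi)) /=.
rewrite [X in _ + X]big1 ?addr0; last first.
  by move=> phi /g0 ->; rewrite scaler0.
rewrite (partition_big (fun phi => [set phi x | x in I]) predT) //=.
apply: big1 => S _.
case: (pickP (fun phi => injectiveb phi && ([set phi x | x in I] == S)))
  => [phi0|no_phi]; last by rewrite big_pred0.
case/andP=> /injectiveP inj0 /eqP im0.
have inj_h : injective (ffperm phi0).
  move=> s s' /ffunP eq_s; apply/permP => x; apply: inj0.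
  by have := eq_s x; rewrite !ffunE.
rewrite (eq_bigl (mem [set ffperm phi0 s | s : {perm I}])); last first.
  move=> phi; rewrite inE.
  apply/andP/imsetP => [[/injectiveP inj1 /eqP im1]|[s _ ->]].
    have [|s ->] := ffperm_trans inj0 inj1; first by rewrite im0 im1.
    by exists s.
  split; first by apply/injectiveP => x y; rewrite !ffunE => /inj0 /perm_inj.
  rewrite -im0; apply/eqP/setP => z; apply/imsetP/imsetP => -[x _ ->].
    by rewrite ffunE; exists (s x).
  by exists (s^-1 x)%g; rewrite // ffunE permKV.
rewrite big_imset /=; last by move=> s s' _ _; apply: inj_h.
under eq_bigr => s _ do rewrite gs scalerA mulrC.
by rewrite -scaler_suml big_mkcond /= as0 ?scale0r.
Qed.
End AlternatingSum.

(** * Products of anticommuting elements of square zero *)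

Section SeqProduct.
Variables (E : nzRingType) (T : eqType) (u : T -> E).
Hypothesis u_sq : forall x, u x * u x = 0.
Hypothesis u_anti : forall x y, u x * u y = - (u y * u x).

Lemma prod_anticomm x (s : seq T) :
  u x * \prod_(y <- s) u y = (-1) ^+ size s * (\prod_(y <- s) u y * u x).
Proof.
elim: s => [|y s IHs]; first by rewrite big_nil mul1r mulr1 expr0 mul1r.
rewrite big_cons mulrA u_anti mulNr -[u y * u x * _]mulrA IHs exprS.
rewrite mulN1r mulNr.
congr (- _); rewrite !mulrA; congr (_ * _ * _).
by rewrite -signr_odd commr_sign.
Qed.

(** Bring the first of two equal factors next to the second one. *)
Lemma prod_nonuniq s : ~~ uniq s -> \prod_(y <- s) u y = 0.
Proof.
elim: s => // x s IHs /=; rewrite negb_and negbK big_cons.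
case/orP=> [/splitPr[s1 s2]|/IHs ->]; last by rewrite mulr0.
rewrite big_cat big_cons /= mulrA prod_anticomm -!mulrA [u x * (u x * _)]mulrA.
by rewrite u_sq mul0r !mulr0.
Qed.

(** Moving x to the right and y to the left across the product over s2
    costs twice the same sign, so only the sign of the exchange of x and y
    remains. *)
Lemma prod_swap s1 s2 s3 x y :
  \prod_(z <- s1 ++ x :: s2 ++ y :: s3) u z =
  - \prod_(z <- s1 ++ y :: s2 ++ x :: s3) u z.
Proof.
rewrite !(big_cat, big_cons) /= -mulrN; congr (_ * _).
rewrite !mulrA prod_anticomm [in RHS]prod_anticomm -mulNr; congr (_ * _).
by rewrite -!mulrA u_anti !mulrN.
Qed.
End SeqProduct.

Section FamilyProduct.
Variables (E : nzRingType) (I : finType) (T : eqType) (v : T -> E).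
Hypothesis v_sq : forall x, v x * v x = 0.
Hypothesis v_anti : forall x y, v x * v y = - (v y * v x).

Let prod_enum (F : I -> E) : \prod_i F i = \prod_(i <- enum I) F i.
Proof. by rewrite [index_enum _]unlock -enumT. Qed.

Lemma prod_noninj (h : I -> T) : ~~ injectiveb h -> \prod_i v (h i) = 0.
Proof.
move=> ninj; rewrite prod_enum -(big_map h xpredT v) /=.
exact: prod_nonuniq.
Qed.

Lemma prod_tperm (h : I -> T) (i k : I) : i != k ->
  \prod_l v (h (tperm i k l)) = - \prod_l v (h l).
Proof.
move=> neq_ik; rewrite !prod_enum.
have := enum_uniq I; have : i \in enum I by rewrite mem_enum.
have : k \in enum I by rewrite mem_enum.
move: (enum I) => s k_s i_s.
wlog [s1 [s2 [s3 ->]]] : i k neq_ik {k_s i_s} /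
    exists s1 s2 s3, s = s1 ++ i :: s2 ++ k :: s3.
  move=> IH uniq_s; case/splitPr: i_s k_s uniq_s IH => s1 s2.
  rewrite mem_cat in_cons eq_sym (negbTE neq_ik) /=.
  case/orP => [/splitPr[s0 s1']|/splitPr[s1' s3]] uniq_s IH.
    rewrite tpermC; apply: IH => //; first by rewrite eq_sym.
    by exists s0, s1', s2; rewrite -catA.
  by apply: IH => //; exists s1, s1', s3.
rewrite cat_uniq /= cat_uniq /= !has_cat !mem_cat !in_cons !negb_or.
case/and5P=> _ /and3P[i_s1 _ /andP[k_s1 _]] /and3P[i_s2 _ i_s3] _.
case/andP=> /andP[k_s2 _] /andP[k_s3 _].
have fix_s s0 : i \notin s0 -> k \notin s0 ->
   \prod_(l <- s0) v (h (tperm i k l)) = \prod_(l <- s0) v (h l).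
  move=> i_s0 k_s0; apply: eq_big_seq => l l_s0.
  by rewrite tpermD //; apply: contraTneq l_s0 => <-.
rewrite -[\prod_(l <- _ ++ _) v (h l)](big_map h xpredT v).
rewrite map_cat /= map_cat /=.
rewrite [in RHS](prod_swap v_anti) opprK.
rewrite !(big_cat, big_cons, big_map) /= tpermL tpermR !fix_s //.
Qed.

Lemma prod_perm (h : I -> T) (s : {perm I}) :
  \prod_l v (h (s l)) = (-1) ^+ s * \prod_l v (h l).
Proof.
have [ts -> /=] := prod_tpermP s; elim: ts h => [|[i k] ts IHts] h.
  rewrite big_nil odd_perm1 mul1r => _.
  by apply: eq_bigr => l _; rewrite perm1.
case/andP=> /= neq_ik /IHts {}IHts; rewrite big_cons odd_permM odd_tperm neq_ik.
under eq_bigr => l _ do rewrite permM.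
rewrite (prod_tperm (fun l => h ((\prod_(t <- ts) tperm t.1 t.2)%g l))) //.
by rewrite IHts signr_addb mulN1r mulNr.
Qed.
End FamilyProduct.

(** * Degree modulo a power of the indeterminate *)

Section TruncatedDegree.
Variable A : comNzRingType.
Implicit Types (p q : {poly A}) (d N : nat).

(** The class of p modulo 'X^(N.+1) has a representative of degree at most
    d. *)
Definition trunc_deg_le N d p := forall k, (d < k <= N)%N -> p`_k = 0.

Lemma trunc_deg_le_sum N d (I : Type) (s : seq I) (P : pred I)
    (F : I -> {poly A}) :
  (forall i, P i -> trunc_deg_le N d (F i)) ->
  trunc_deg_le N d (\sum_(i <- s | P i) F i).
Proof. by move=> lowF k k_dN; rewrite coef_sum big1 // => i /lowF ->. Qed.

Lemma trunc_deg_le_mul N d e p q :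
  trunc_deg_le N d p -> trunc_deg_le N e q ->
  trunc_deg_le N (d + e) (p * q).
Proof.
move=> lowp lowq k /andP[lt_k le_k]; rewrite coefM big1 // => [[i /= lt_i]] _.
have [lt_di|le_id] := ltnP d i.
  by rewrite lowp ?mul0r // lt_di (leq_trans _ le_k).
rewrite lowq ?mulr0 // (leq_trans (leq_subr _ _) le_k) andbT.
by rewrite ltn_subRL (leq_ltn_trans _ lt_k) ?leq_add2r.
Qed.

Lemma trunc_deg_le_const N d c : trunc_deg_le N d c%:P.
Proof. by move=> [|k] //; rewrite coefC. Qed.

Lemma trunc_deg_le_prod N (I : Type) (s : seq I) (d : I -> nat)
    (F : I -> {poly A}) :
  (forall i, trunc_deg_le N (d i) (F i)) ->
  trunc_deg_le N (\sum_(i <- s) d i) (\prod_(i <- s) F i).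
Proof.
move=> lowF; elim: s => [|i s IHs].
  by rewrite !big_nil; apply: trunc_deg_le_const.
by rewrite !big_cons; apply: trunc_deg_le_mul.
Qed.

Lemma trunc_deg_le_det N n (d : 'I_n -> nat) (Z : 'M[{poly A}]_n) :
  (forall i j, trunc_deg_le N (d i) (Z i j)) ->
  trunc_deg_le N (\sum_i d i) (\det Z).
Proof.
move=> lowZ; apply: trunc_deg_le_sum => s _.
rewrite -[X in trunc_deg_le _ X _]add0n.
apply: trunc_deg_le_mul; last exact: trunc_deg_le_prod.
by case: (odd_perm s); rewrite ?expr1 -?polyCN; apply: trunc_deg_le_const.
Qed.

(** Jacobi's complementary minor argument for the first j columns: the block
    matrix with rows V and (0 1) has determinant det (lsubmx V), and its
    product with X has the rows of V *m X, of degree 0, followed by the last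
    n rows of X, of degree 1. *)
Lemma trunc_deg_le_lminor N j n (V : 'M[{poly A}]_(j, j + n))
    (X : 'M_(j + n)) :
  (forall l a, trunc_deg_le N 0 ((V *m X) l a)) ->
  (forall a b, trunc_deg_le N 1 (X a b)) ->
  trunc_deg_le N n (\det X * \det (lsubmx V)).
Proof.
move=> lowVX lowX.
have -> : \det X * \det (lsubmx V) = \det (col_mx (V *m X) (dsubmx X)).
  rewrite mulrC -[\det (lsubmx V)]mulr1 -(det1 _ n) -(det_ublock _ (rsubmx V)).
  rewrite -det_mulmx block_mxEv hsubmxK mul_col_mx; congr (\det (col_mx _ _)).
  by rewrite -[X in _ *m X]vsubmxK mul_row_col mul0mx mul1mx add0r.
pose d (i : 'I_(j + n)) : nat := if split i is inl _ then 0 else 1.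
have sum_d : (\sum_i d i)%N = n.
  rewrite /d big_split_ord /=.
  under eq_bigr => l _ do rewrite (unsplitK (inl l)).
  under [X in (_ + X)%N]eq_bigr => l _ do rewrite (unsplitK (inr l)).
  by rewrite big1 // sum1_card card_ord.
rewrite -[X in trunc_deg_le _ X _]sum_d; apply: trunc_deg_le_det => i b.
rewrite mxE /d.
by case: split => l; [apply: lowVX | rewrite mxE; apply: lowX].
Qed.

Lemma perm_extend j n (phi : 'I_j -> 'I_(j + n)) : injective phi ->
  exists pi : 'S_(j + n), forall l, pi (lshift n l) = phi l.
Proof.
move=> inj_phi; pose S := [set phi l | l : 'I_j].
have cardS : #|~: S| = n.
  by apply/eqP; rewrite -(eqn_add2l #|S|) cardsC card_imset // !card_ord.
pose psi (i : 'I_(j + n)) := match split i with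
  | inl l => phi l | inr k => enum_val (cast_ord (esym cardS) k) end.
have notS (k : 'I_n) : enum_val (cast_ord (esym cardS) k) \notin S.
  by have := enum_valP (cast_ord (esym cardS) k); rewrite inE.
have inj_psi : injective psi.
  move=> i i'; rewrite -(splitK i) -(splitK i') /psi !unsplitK.
  case: (split i) (split i') => [l|k] [l'|k']
    => [/inj_phi -> | eq_psi | eq_psi |] //.
  - by case/negP: (notS k'); rewrite -eq_psi imset_f.
  - by case/negP: (notS k); rewrite eq_psi imset_f.
  by move/enum_val_inj/cast_ord_inj => ->.
by exists (perm inj_psi) => l; rewrite permE /psi (unsplitK (inl l)).
Qed.

(** Renumbering the coordinates brings the columns phi to the front;
    conjugating X by the same permutation keeps its determinant and the
    degrees of its entries. *)
Lemma trunc_deg_le_minor N j r (V : 'M[{poly A}]_(j, r)) (X : 'M_r)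
    (phi : 'I_j -> 'I_r) :
  injective phi ->
  (forall l a, trunc_deg_le N 0 ((V *m X) l a)) ->
  (forall a b, trunc_deg_le N 1 (X a b)) ->
  trunc_deg_le N (r - j) (\det X * \det (colsub phi V)).
Proof.
move=> inj_phi; have le_jr : (j <= r)%N.
  by rewrite -[j]card_ord -[r in (_ <= r)%N]card_ord; apply: leq_card inj_phi.
have /esym def_r := subnKC le_jr; move: (r - j)%N def_r => n def_r; subst r.
move=> lowVX lowX; have [pi def_phi] := perm_extend inj_phi.
pose X' := row_perm pi (col_perm pi X).
have detX' : \det X' = \det X.
  rewrite /X' row_permE col_permE !det_mulmx !det_perm odd_permV.
  by rewrite mulrCA -expr2 sqrr_sign mulr1.
have -> : colsub phi V = lsubmx (col_perm pi V).
  by apply/matrixP=> l a; rewrite !mxE def_phi.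
rewrite -detX'; apply: trunc_deg_le_lminor => [l a|a b]; last first.
  by rewrite !mxE; apply: lowX.
have -> : col_perm pi V *m X' = col_perm pi (V *m X).
  rewrite /X' row_permE !col_permE !mulmxA -[_ *m perm_mx pi]mulmxA -perm_mxM.
  by rewrite mulVg perm_mx1 mulmx1.
by rewrite mxE; apply: lowVX.
Qed.
End TruncatedDegree.

(** * Generation of the exterior algebra by degree one *)

Section Span.
Variables (A : comNzRingType) (M : lmodType A) (E : algType A).
Variable iota : {linear M -> E}.

Definition in_span (x : E) : Prop :=
  exists s : seq (A * seq M), x = \sum_(p <- s) p.1 *: \prod_(m <- p.2) iota m.

(** A boolean predicate, so that the span carries the structure of a
    subalgebra. *)
Definition span_pred : {pred E} := fun x => `[< in_span x >].

Lemma in_span_prod s : in_span (\prod_(m <- s) iota m).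
Proof. by exists [:: (1, s)]; rewrite big_seq1 scale1r. Qed.

Lemma in_span_closed : GRing.subsemialg_closed span_pred.
Proof.
split.
- by apply/asboolP; have := in_span_prod [::]; rewrite big_nil.
- split; first by apply/asboolP; exists [::]; rewrite big_nil.
  move=> x y /asboolP[s ->] /asboolP[s' ->]; apply/asboolP.
  by exists (s ++ s'); rewrite big_cat.
- move=> a x /asboolP[s ->]; apply/asboolP.
  exists [seq (a * p.1, p.2) | p <- s]; rewrite big_map scaler_sumr.
  by apply: eq_bigr => p _; rewrite scalerA.
move=> x y /asboolP[s ->] /asboolP[s' ->]; apply/asboolP.
exists [seq (p.1 * q.1, p.2 ++ q.2) | p <- s, q <- s'].
rewrite big_allpairs_dep mulr_suml; apply: eq_bigr => p _.
rewrite mulr_sumr; apply: eq_bigr => q _ /=.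
by rewrite big_cat -scalerAl -scalerAr scalerA.
Qed.

HB.instance Definition _ :=
  GRing.isSubSemiAlgClosed.Build A E span_pred in_span_closed.

Definition span_alg := {x : E | x \in span_pred}.
HB.instance Definition _ := SubChoice.on span_alg.
HB.instance Definition _ := [SubChoice_isSubAlgebra of span_alg by <:].

(** The inclusion of the subalgebra, as a morphism of algebras. *)
Definition span_val (x : span_alg) : E := val x.
Fact span_val_linear : linear span_val. Proof. by []. Qed.
Fact span_val_monoid : monoid_morphism span_val. Proof. by []. Qed.
HB.instance Definition _ :=
  GRing.isLinear.Build A span_alg E _ span_val span_val_linear.
HB.instance Definition _ :=
  GRing.isMonoidMorphism.Build span_alg E span_val span_val_monoid.
End Span.

Section Generation.
Variables (A : comNzRingType) (M : lmodType A) (E : algType A).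
Variable iota : {linear M -> E}.

(** The universal property maps E to the span of the products, compatibly
    with iota; composed with the inclusion of the span this is the identity of
    E by uniqueness. *)
Lemma exterior_spanned (x : E) : is_exterior_algebra iota -> in_span iota x.
Proof.
case=> iota_sq univ.
have iota_in m : iota m \in span_pred iota.
  by apply/asboolP; have := in_span_prod iota [:: m]; rewrite big_seq1.
pose j m : span_alg iota := Sub (iota m) (iota_in m).
have j_lin : linear j.
  by move=> a m m'; apply: val_inj; rewrite /= linearP.
pose jL := GRing.isLinear.Build _ _ _ _ j j_lin.
pose jl : {linear M -> span_alg iota} := HB.pack j jL.
have [|psi [psiE _]] := univ (span_alg iota) jl.
  by move=> m; apply: val_inj; rewrite /= iota_sq.
have [id' [_ uniq_id]] := univ E iota iota_sq.
pose psi' : {lrmorphism E -> E} :=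
  (@span_val _ _ _ iota \o psi : {lrmorphism E -> E}).
have <- : psi' x = x.
  rewrite (uniq_id psi'); last by move=> m; rewrite /= psiE.
  by rewrite -(uniq_id (idfun : {lrmorphism E -> E})).
exact/asboolP/(valP (psi x)).
Qed.

Lemma sq0_anticomm : (forall m, iota m * iota m = 0) ->
  forall x y, iota x * iota y = - (iota y * iota x).
Proof.
move=> iota_sq x y; apply/eqP; rewrite -addr_eq0.
have := iota_sq (x + y).
by rewrite linearD mulrDl !mulrDr !iota_sq add0r addr0 => ->.
Qed.
End Generation.

(** * Coefficients of products of power series *)

Section Series.
Variables (A : comNzRingType) (E : algType A).

(** The coefficients up to N of a product of power series depend only on
    those of the factors, which may thus be replaced by polynomials. *)
Lemma ps_prod_coef (I : Type) (s : seq I) (P : I -> nat -> E)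
    (p : I -> {poly E}) N :
  (forall l k, (k <= N)%N -> P l k = (p l)`_k) ->
  forall k, (k <= N)%N ->
   (\big[@ps_mul E/@ps_one E]_(l <- s) P l) k = (\prod_(l <- s) p l)`_k.
Proof.
move=> eqPp; elim: s => [|l s IHs] k le_k.
  by rewrite !big_nil coef1.
rewrite !big_cons coefM; apply: eq_bigr => i _.
rewrite eqPp ?IHs ?(leq_trans (leq_subr _ _)) //.
by rewrite (leq_trans _ le_k) // -ltnS.
Qed.

(** Polynomials with scalar coefficients are central in {poly E}. *)
Lemma prod_scaled_coef (I : Type) (s : seq I) (p : I -> {poly A})
    (b : I -> E) k :
  (\prod_(l <- s) (map_poly (in_alg E) (p l) * (b l)%:P))`_k =
  (\prod_(l <- s) p l)`_k *: \prod_(l <- s) b l.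
Proof.
have comm c (q : {poly A}) :
    c%:P * map_poly (in_alg E) q = map_poly (in_alg E) q * c%:P.
  by apply/polyP => i; rewrite coefCM coefMC coef_map /= mulr_algl mulr_algr.
suff -> : \prod_(l <- s) (map_poly (in_alg E) (p l) * (b l)%:P) =
   map_poly (in_alg E) (\prod_(l <- s) p l) * (\prod_(l <- s) b l)%:P.
  by rewrite coefMC coef_map /= mulr_algl.
elim: s => [|l s IHs]; first by rewrite !big_nil rmorph1 mulr1.
rewrite !big_cons IHs rmorphM polyCM !mulrA; congr (_ * _).
by rewrite -!mulrA comm.
Qed.
End Series.

(** * The operators attached to an endomorphism *)

Section CayleyHamilton.
Variables (A : comNzRingType) (M : vectType A) (f : 'End(M)) (E : algType A).
Variables (iota : {linear M -> E}).
Hypothesis iota_sq : forall m, iota m * iota m = 0.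
Variable D : nat -> {linear E -> E}.
Hypothesis serD : is_wedge_series iota (lfun_pow f) D.
Import VectorInternalTheory.

Let b (a : 'I_(dim M)) : M := r2v (delta_mx 0 a).

Lemma v2r_lfun v : v2r (f v) = v2r v *m lfun_mx f.
Proof. by rewrite unlock /= r2vK. Qed.

Lemma iota_coord v : iota v = \sum_a v2r v 0 a *: iota (b a).
Proof.
rewrite -[in LHS](v2rK v) [v2r v in LHS]row_sum_delta !linear_sum.
by apply: eq_bigr => a _; rewrite !linearZ.
Qed.

(** The l-th row holds the coordinates of (1 - t f)^-1 (m l), modulo
    t^(N+1). *)
Definition orbit_mx N j (m : 'I_j -> M) : 'M[{poly A}]_(j, dim M) :=
  \matrix_(l, a) \poly_(k < N.+1) v2r (lfun_pow f k (m l)) 0 a.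

Definition one_sub_mx : 'M[{poly A}]_(dim M) :=
  1%:M - 'X *: map_mx polyC (lfun_mx f).

Lemma trunc_deg_le_one_sub_mx N a c : trunc_deg_le N 1 (one_sub_mx a c).
Proof.
move=> [|[|k]] //= _; rewrite !mxE coefB coefXM coefC /= subr0.
by case: (a == c); rewrite ?mulr1n ?mulr0n ?coef0 // coefC.
Qed.

(** Row l of the product is (1 - t f)(1 - t f)^-1 (m l) = m l in coordinates:
    the coefficients telescope. *)
Lemma trunc_deg_le_orbit_one_sub_mx N j (m : 'I_j -> M) l a :
  trunc_deg_le N 0 ((orbit_mx N m *m one_sub_mx) l a).
Proof.
move=> [|k] //= lt_kN; rewrite mulmxBr mulmx1 -scalemxAr !mxE coefB coefXM /=.
rewrite coef_poly ltnS lt_kN /lfun_pow /= comp_lfunE.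
rewrite v2r_lfun mxE coef_sum; apply/eqP.
rewrite subr_eq0; apply/eqP; apply: eq_bigr => c _.
by rewrite !mxE coefMC coef_poly ltnS ltnW.
Qed.

(** The expansion of D(t)(m_1 /\ ... /\ m_j) on the products of basis vectors,
    the coefficients being taken in A[t] up to degree N. *)
Lemma D_wedge N n j (m : 'I_j -> M) : (n <= N)%N ->
  D n (wedge iota m) =
  \sum_(phi : {ffun 'I_j -> 'I_(dim M)})
    (\prod_l orbit_mx N m l (phi l))`_n *: \prod_l iota (b (phi l)).
Proof.
move=> le_nN.
have -> : D n (wedge iota m) =
   (\big[@ps_mul E/@ps_one E]_(l < j) (fun k => iota (lfun_pow f k (m l)))) n.
  (* For j = 0 the value comes from the clause on scalars. *)
  case: serD => D0 Dj; case: j m => [|j] m; last exact: Dj.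
  rewrite /wedge !big_ord0 -(scale1r 1) D0 /ps_one scale1r.
  by case: eqP.
rewrite (@ps_prod_coef A E _ _ _ (fun l => \sum_a
    (map_poly (in_alg E) (orbit_mx N m l a) * (iota (b a))%:P)) N) //.
  rewrite bigA_distr_bigA coef_sum; apply: eq_bigr => phi _.
  exact: prod_scaled_coef.
move=> l k le_k; rewrite iota_coord coef_sum; apply: eq_bigr => a _.
by rewrite coefMC coef_map /= mulr_algl mxE coef_poly ltnS le_k.
Qed.

(** On the j-th exterior power det (1 - t f) D(t) has degree at most dim M - j:
    its coefficients on products of basis vectors combine into the minors
    bounded by [trunc_deg_le_minor]. *)
Lemma ch_op_wedge i j (m : 'I_j -> M) : (dim M < i + j)%N ->
  ch_op f D i i (wedge iota m) = 0.
Proof.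
move=> lt_r.
have iota_anti := sq0_anticomm iota_sq.
have -> : ch_op f D i i (wedge iota m) =
  \sum_(phi : {ffun 'I_j -> 'I_(dim M)})
    (\det one_sub_mx * \prod_l orbit_mx i m l (phi l))`_i *:
       \prod_l iota (b (phi l)).
  rewrite /ch_op; under [RHS]eq_bigr => phi _ do rewrite coefM scaler_suml.
  rewrite exchange_big; apply: eq_bigr => l _.
  rewrite (D_wedge _ (leq_subr l i)) !scalerA /esc mulrA -expr2 sqrr_sign mul1r.
  by rewrite scaler_sumr; apply: eq_bigr => phi _; rewrite scalerA.
apply: (sum_alternating_eq0 (g := fun phi => \prod_l iota (b (phi l)))).
- move=> phi ninj.
  by apply: (prod_noninj (v := iota \o b)) => * //=; apply: iota_anti.
- move=> phi s; under eq_bigr => l _ do rewrite ffunE.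
  rewrite (prod_perm iota_anti (fun l => b (phi l))).
  case: (odd_perm s); rewrite ?mul1r ?scale1r //.
  by rewrite mulN1r scaleN1r.
move=> phi inj_phi.
have lowDV : trunc_deg_le i (dim M - j)
    (\det one_sub_mx * \det (colsub phi (orbit_mx i m))).
  apply: trunc_deg_le_minor => // *; last exact: trunc_deg_le_one_sub_mx.
  exact: trunc_deg_le_orbit_one_sub_mx.
(* If j > dim M the truncated difference dim M - j is 0, which would not *)
(* cover i = 0; the existence of phi excludes this. *)
have le_jr : (j <= dim M)%N.
  by rewrite -[j]card_ord -[dim M]card_ord; apply: leq_card inj_phi.
have lt_i : (dim M - j < i <= i)%N by rewrite leqnn -(ltn_add2r j) subnK ?lt_r.
apply: etrans (lowDV i lt_i).
rewrite [\det (colsub _ _)]/determinant mulr_sumr coef_sum.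
apply: eq_bigr => s _.
under eq_bigr => l _ do rewrite ffunE.
under [in RHS]eq_bigr => l _ do rewrite mxE.
rewrite [in RHS]mulrCA.
by case: (odd_perm s); rewrite ?mul1r // !mulN1r coefN.
Qed.

Lemma ch_op_scale k i a x : ch_op f D k i (a *: x) = a *: ch_op f D k i x.
Proof.
rewrite /ch_op scaler_sumr; apply: eq_bigr => l _.
by rewrite [D _ _]linearZ !scalerA; congr (_ *: _); rewrite mulrC mulrA.
Qed.

Lemma ch_op_sum k i (I : Type) (s : seq I) (P : pred I) (F : I -> E) :
  ch_op f D k i (\sum_(t <- s | P t) F t) =
  \sum_(t <- s | P t) ch_op f D k i (F t).
Proof.
rewrite /ch_op [RHS]exchange_big; apply: eq_bigr => l _.
by rewrite !linear_sum.
Qed.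

(** The polynomial det (1 - t f) has degree at most dim M, so the scalars
    e_l with l > dim M vanish and the longer sum adds nothing. *)
Lemma ch_op_saturate i x : (dim M <= i)%N ->
  ch_op f D (dim M) i x = ch_op f D i i x.
Proof.
move=> le_ri.
have lowdet : trunc_deg_le i (dim M) (\det one_sub_mx).
  have sum1 : (\sum_(a < dim M) 1)%N = dim M by rewrite sum1_card card_ord.
  rewrite -[X in trunc_deg_le _ X _]sum1; apply: trunc_deg_le_det => *.
  exact: trunc_deg_le_one_sub_mx.
rewrite /ch_op [RHS](bigID (fun l : 'I_i.+1 => l < (dim M).+1)%N) /=.
rewrite [X in _ + X]big1 ?addr0 => [|l]; last first.
  rewrite -leqNgt => lt_l; rewrite /esc [_`_l]lowdet.
    by rewrite mulr0 scale0r scaler0.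
  by rewrite lt_l -ltnS ltn_ord.
pose F l := (-1) ^+ l *: (esc f l *: D (i - l)%N x).
by rewrite -(big_ord_widen i.+1 F).
Qed.

Lemma ch_op_ext_power i j x : (dim M < i + j)%N -> in_ext_power iota j x ->
  ch_op f D i i x = 0.
Proof.
move=> lt_r [n [c [m ->]]]; rewrite ch_op_sum big1 // => s _.
by rewrite ch_op_scale ch_op_wedge ?scaler0.
Qed.

Lemma ch_op_ext_gt d i x : (dim M <= i + d)%N -> in_ext_gt iota d x ->
  ch_op f D i i x = 0.
Proof.
move=> le_r [y [ypow ->]].
rewrite ch_op_sum big_nat big1 // => j /andP[lt_dj _].
by apply: ch_op_ext_power (ypow j); rewrite (leq_ltn_trans le_r) ?ltn_add2l.
Qed.

Lemma ch_op_span i x : (dim M < i)%N -> in_span iota x -> ch_op f D i i x = 0.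
Proof.
move=> lt_r [s ->]; rewrite ch_op_sum big1 // => p _.
rewrite ch_op_scale big_tnth; set w := \prod_(l < _) _.
have -> : w = wedge iota (tnth (in_tuple p.2)) by [].
by rewrite ch_op_wedge ?scaler0 // ltn_addr.
Qed.
End CayleyHamilton.

Theorem theorem2p3 (A : comNzRingType) (M : vectType A) (r : nat)
    (rankM : dim M = r) (f : 'End(M))
    (E : algType A) (iota : {linear M -> E})
    (extE : is_exterior_algebra iota)
    (D : nat -> {linear E -> E})
    (serD : is_wedge_series iota (lfun_pow f) D) :
  (* (1) *)
  (forall k : nat, (1 <= k < r)%N ->
     forall x : E, in_ext_gt iota (r - k) x -> ch_op f D k k x = 0) /\
  (* (2); for i = r the operator is (-1)^r e_r on degree 0 (ch_op_degree0), *)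
  (* so there it can only vanish on the part of positive degree             *)
  (forall i : nat, (r < i)%N -> forall x : E, ch_op f D r i x = 0) /\
  (forall x : E, in_ext_gt iota 0 x -> ch_op f D r r x = 0).
Proof.
have iota_sq := proj1 extE; rewrite -rankM; split; [|split].
- move=> k /andP[_ /ltnW le_kr] x.
  by apply: (ch_op_ext_gt iota_sq serD); rewrite subnKC.
- move=> i lt_ri x; rewrite ch_op_saturate 1?ltnW //.
  by apply: (ch_op_span iota_sq serD lt_ri); apply: exterior_spanned.
by move=> x; apply: (ch_op_ext_gt iota_sq serD); rewrite addn0.
Qed.
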